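(* Suppose the Banach algebra $A$ is approximately semi-amenable and $J$ is a closed two-sided ideal of $A$ which is complemented in $A$ (i.e. there is a bounded linear projection $P:A\to J$ onto $J$). Then $J$ has a left approximate identity and a right approximate identity.
   Context: Approximate identities here need not be bounded: a right (left) approximate identity of $J$ is a net $(u_\alpha)$ in $J$ with $xu_\alpha\to x$ (resp. $u_\alpha x\to x$) for all $x\in J$. For a Banach $A$-bimodule $X$, $X^*$ is a Banach $A$-bimodule via $\langle a\cdot f,x\rangle=\langle f,x\cdot a\rangle$, $\langle f\cdot a,x\rangle=\langle f,a\cdot x\rangle$; a derivation is a linear $D:A\to X^*$ with $D(ab)=a\cdot D(b)+D(a)\cdot b$; it is approximately semi-inner if there are nets $(\xi_i),(\eta_i)$ in $X^*$ with $D(a)=\lim_i(a\cdot\xi_i-\eta_i\cdot a)$ in norm for all $a\in A$. $A$ is approximately semi-amenable if for every Banach $A$-bimodule $X$ every continuous derivation $A\to X^*$ is approximately semi-inner. *)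

(* Defs.v *)
(* Banach algebras over a generic numFieldType K;
   the theorem instantiates K with the complex numbers R[i] over R : realType. *)
From HB Require Import structures.
From mathcomp Require Import all_boot all_order all_algebra.
From mathcomp Require Import all_classical all_reals all_analysis.
From mathcomp Require Export complex.
Set Implicit Arguments. Unset Strict Implicit. Unset Printing Implicit Defensive.
Import Order.TTheory GRing.Theory Num.Theory.
Import numFieldNormedType.Exports.
Local Open Scope ring_scope.
Local Open Scope classical_set_scope.

Section BanachDefs.
Variable K : numFieldType.

Record directed_set := DirectedSet {
  dI :> Type;
  dle : dI -> dI -> Prop;
  dle_refl : forall i, dle i i;
  dle_trans : forall i j k, dle i j -> dle j k -> dle i k;
  dI_inhabited : inhabited dI;
  dI_directed : forall i j, exists k, dle i k /\ dle j k }.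

Definition net_cvg (V : normedModType K) (I : directed_set) (u : I -> V) (l : V) :=
  forall e : K, 0 < e -> exists i0 : I, forall i, dle i0 i -> `|u i - l| <= e.

Definition is_banach_algebra (A : completeNormedModType K) (m : A -> A -> A) :=
  [/\ (forall a b c, m (m a b) c = m a (m b c)),
      (forall (k : K) a b c, m (k *: a + b) c = k *: m a c + m b c),
      (forall (k : K) a b c, m a (k *: b + c) = k *: m a b + m a c) &
      (forall a b, `|m a b| <= `|a| * `|b|) ].

Definition is_banach_bimodule (A : completeNormedModType K) (m : A -> A -> A)
  (X : completeNormedModType K) (la : A -> X -> X) (ra : X -> A -> X) :=
  (forall (k : K) a b x, la (k *: a + b) x = k *: la a x + la b x) /\
  (forall (k : K) a x y, la a (k *: x + y) = k *: la a x + la a y) /\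
  (forall (k : K) a b x, ra x (k *: a + b) = k *: ra x a + ra x b) /\
  (forall (k : K) a x y, ra (k *: x + y) a = k *: ra x a + ra y a) /\
  (forall a b x, la (m a b) x = la a (la b x)) /\
  (forall a b x, ra x (m a b) = ra (ra x a) b) /\
  (forall a b x, ra (la a x) b = la a (ra x b)) /\
  (forall a x, `|la a x| <= `|a| * `|x|) /\
  (forall a x, `|ra x a| <= `|a| * `|x|).

Definition in_dual (X : normedModType K) (f : X -> K) :=
  (forall (k : K) x y, f (k *: x + y) = k * f x + f y) /\
  exists M : K, forall x, `|f x| <= M * `|x|.

Definition dual_lact (A : Type) (X : Type) (ra : X -> A -> X)
  (a : A) (f : X -> K) : X -> K := fun x => f (ra x a).
Definition dual_ract (A : Type) (X : Type) (la : A -> X -> X)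
  (f : X -> K) (a : A) : X -> K := fun x => f (la a x).

(* Norm convergence of a net of functionals in X^*: ||g_i - g|| -> 0. *)
Definition dual_net_cvg (X : normedModType K) (I : directed_set)
  (g : I -> X -> K) (l : X -> K) :=
  forall e : K, 0 < e -> exists i0 : I, forall i, dle i0 i ->
    forall x, `|g i x - l x| <= e * `|x|.

Definition is_cont_derivation (A : completeNormedModType K) (m : A -> A -> A)
  (X : completeNormedModType K) (la : A -> X -> X) (ra : X -> A -> X)
  (D : A -> X -> K) :=
  [/\ (forall a, in_dual (D a)),
      (forall (k : K) a b x, D (k *: a + b) x = k * D a x + D b x),
      (forall a b x, D (m a b) x = dual_lact ra a (D b) x + dual_ract la (D a) b x) &
      exists M : K, forall a x, `|D a x| <= M * `|a| * `|x| ].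

Definition approx_semi_inner (A : completeNormedModType K)
  (X : completeNormedModType K) (la : A -> X -> X) (ra : X -> A -> X)
  (D : A -> X -> K) :=
  exists (I : directed_set) (xi eta : I -> X -> K),
    (forall i, in_dual (xi i)) /\ (forall i, in_dual (eta i)) /\
    forall a : A, dual_net_cvg
      (fun i x => dual_lact ra a (xi i) x - dual_ract la (eta i) a x) (D a).

Definition approx_semi_amenable (A : completeNormedModType K) (m : A -> A -> A) :=
  forall (X : completeNormedModType K) (la : A -> X -> X) (ra : X -> A -> X),
    is_banach_bimodule m la ra ->
    forall D : A -> X -> K, is_cont_derivation m la ra D ->
      approx_semi_inner la ra D.

Definition is_closed_ideal (A : completeNormedModType K) (m : A -> A -> A)
  (J : set A) :=
  [/\ J 0, (forall (k : K) x y, J x -> J y -> J (k *: x + y)),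
      (forall a x, J x -> J (m a x) /\ J (m x a)) & closed J ].

Definition complemented (A : completeNormedModType K) (J : set A) :=
  exists P : A -> A,
    [/\ (forall (k : K) x y, P (k *: x + y) = k *: P x + P y),
        continuous P, (forall x, J (P x)) & (forall x, J x -> P x = x) ].

Definition has_right_approx_identity (A : completeNormedModType K)
  (m : A -> A -> A) (J : set A) :=
  exists (I : directed_set) (u : I -> A),
    (forall i, J (u i)) /\ forall x, J x -> net_cvg (fun i => m x (u i)) x.
Definition has_left_approx_identity (A : completeNormedModType K)
  (m : A -> A -> A) (J : set A) :=
  exists (I : directed_set) (u : I -> A),
    (forall i, J (u i)) /\ forall x, J x -> net_cvg (fun i => m (u i) x) x.

End BanachDefs.

(* Main.v *)
(** Let [A#] be the unitization of [A] and let [X] be the dual of the bimodule of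
    a universal derivation [d] on [A]: its elements are the bounded trilinear
    forms [g(p, c, q)] on [A# x A x A#] with
    [g(p, c c', q) = g(p c, c', q) + g(p, c, c' q)]. Then [D a g = g(1, a, 1)]
    is a continuous derivation into [X^*], so
    [xi_i (g . a) - eta_i (a . g) -> D a g] for some nets [xi_i], [eta_i].

    Extend the projection [P] onto [J] to [A#] by [P 1 = 0]. Each [f] in [A^*]
    yields [g_f(p, c, q) = f(p (c P(q) - P(c q)))] in [X], and for [x] in [J] one
    has [x . g_f = 0], [g_f . x = g_(f o x)] and [D x g_f = - f x]. If finitely
    many [x_k] in [J] had no common approximate right unit in [J], Hahn-Banach
    would give [phi_k] in [A^*] with [sum_k phi_k (x_k u) = 0] for [u] in [J] but
    [sum_k phi_k (x_k) <> 0]. Then [sum_k g_(phi_k) . x_k = 0], so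
    [0 = sum_k xi_i (g_(phi_k) . x_k) -> - sum_k phi_k (x_k)], a contradiction.
    The left approximate identity comes from the opposite algebra. *)
Require Import Defs.
From HB Require Import structures.
From mathcomp Require Import all_boot all_order all_algebra.
From mathcomp Require Import all_classical all_reals all_analysis.
From mathcomp Require Import complex lra.
Import Order.TTheory GRing.Theory Num.Theory ComplexField.
Import numFieldNormedType.Exports.
Set Implicit Arguments. Unset Strict Implicit. Unset Printing Implicit Defensive.
Local Open Scope ring_scope.
Local Open Scope complex_scope.
Local Open Scope classical_set_scope.

(** * Real scalars inside the complex numbers *)

Lemma ReK (R : realType) (x : R[i]) : 0 <= x -> (complex.Re x)%:C = x.
Proof. by move=> x0; rewrite RRe_real// ger0_real. Qed.

Lemma Re_ge0 (R : realType) (x : R[i]) : 0 <= x -> 0 <= complex.Re x.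
Proof. by move=> x0; rewrite -ler0c ReK. Qed.

Lemma normcR (R : realType) (r : R) : `|r%:C| = `|r|%:C.
Proof. by rewrite normc_def /= expr0n addr0 sqrtr_sqr. Qed.

Lemma normci (R : realType) : `|'i%C : R[i]| = 1.
Proof. by rewrite normc_def /= expr0n expr1n add0r sqrtr1. Qed.

(** * The Hahn-Banach theorem, real and complex *)

Section HahnBanach.
Context {R : realType} {V : lmodType R[i]}.
Implicit Types (p q : V -> R) (v x y : V) (W : set V).

Definition sublinear q :=
  (forall x y, q (x + y) <= q x + q y) /\
  (forall t x, 0 <= t -> q (t%:C *: x) <= t * q x).

Lemma sublinear0 q : sublinear q -> q 0 = 0.
Proof.
move=> [qD qZ]; apply/eqP; rewrite eq_le; apply/andP; split.
  by have := qZ 0 0 (lexx _); rewrite scaler0 mul0r.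
by have := qD 0 0; rewrite addr0; lra.
Qed.

Lemma sublinear_ge q x : sublinear q -> - q (- x) <= q x.
Proof.
move=> sq; have := sq.1 x (- x); rewrite subrr (sublinear0 sq); lra.
Qed.

Lemma sublinearZ q t x : sublinear q -> 0 <= t -> q (t%:C *: x) = t * q x.
Proof.
move=> sq; rewrite le_eqVlt => /orP[/eqP<-|t0].
  by rewrite scale0r mul0r sublinear0.
apply/eqP; rewrite eq_le sq.2 ?(ltW t0)//=.
have := sq.2 t^-1 (t%:C *: x); rewrite invr_ge0 ltW// => /(_ isT).
rewrite scalerA -rmorphM mulVf ?gt_eqF// scale1r.
by rewrite ler_pdivlMl.
Qed.

(* The infimum over a chain of sublinear functionals, and the functional
   [shave q y] below, are both of this form. *)
Lemma inf_sublinear (I : Type) (D : set I) (F : I -> V -> R) (i0 : I) (b : V -> R) :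
  D i0 -> (forall i v, D i -> b v <= F i v) ->
  (forall i j x y, D i -> D j -> exists2 k, D k & F k (x + y) <= F i x + F j y) ->
  (forall i t x, D i -> 0 <= t -> exists2 k, D k & F k (t%:C *: x) <= t * F i x) ->
  sublinear (fun v => inf [set F i v | i in D]) /\
  forall i v, D i -> inf [set F i v | i in D] <= F i v.
Proof.
move=> Di0 bF FD FZ.
have infF i v : D i -> inf [set F i v | i in D] <= F i v.
  move=> Di; apply: ge_inf; last by exists i.
  by exists (b v) => _ [j Dj <-]; exact: bF.
have infP c v : (forall i, D i -> c <= F i v) -> c <= inf [set F i v | i in D].
  move=> cF; apply: lb_le_inf; first by exists (F i0 v); exists i0.
  by move=> _ [j Dj <-]; exact: cF.
split=> //; split=> [x y|t x t0].
  rewrite -lerBlDr; apply: (infP) => i Di; rewrite lerBlDl -lerBlDr.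
  apply: infP => j Dj; have [k Dk] := FD i j x y Di Dj.
  by rewrite lerBlDl; apply: le_trans; exact: infF.
have [<-|t_neq0] := eqVneq 0 t.
  rewrite mul0r; have [k Dk] := FZ i0 0 x Di0 (lexx _).
  by rewrite mul0r; apply: le_trans; exact: infF.
have t_gt0 : 0 < t by rewrite lt_neqAle t_neq0.
rewrite -ler_pdivrMl//; apply: infP => i Di; rewrite ler_pdivrMl//.
by have [k Dk] := FZ i t x Di t0; apply: le_trans; exact: infF.
Qed.

(* A minimal sublinear [q] equals [shave q y], whence [q (- y) = - q y]: this
   is what makes it linear. *)
Definition shave q y v := inf [set q (v + t%:C *: y) - t * q y | t in [set t : R | 0 <= t]].

(** Adding vectors adds the parameters [t] and scaling a vector scales its parameter, so
    [inf_sublinear] applies, with lower bound [- q (- v)]. The parameter 0 gives the bound by [q],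
    the parameter 1 the value at [- y]. *)
Lemma shave_sublinear q y : sublinear q ->
  [/\ sublinear (shave q y), forall v, shave q y v <= q v
    & shave q y (- y) <= - q y].
Proof.
move=> sq.
have [|t v/= t0|s t u v /= s0 t0|s t u /= s0 t0|slin shle] :=
    @inf_sublinear R [set t | 0 <= t]
    (fun t v => q (v + t%:C *: y) - t * q y) 0 (fun v => - q (- v)).
- exact: lexx.
- have := sq.1 (v + t%:C *: y) (- v).
  by rewrite addrAC subrr add0r sublinearZ//; lra.
- exists (s + t); first by rewrite /= addr_ge0.
  have := sq.1 (u + s%:C *: y) (v + t%:C *: y).
  by rewrite addrACA -scalerDl -rmorphD; lra.
- exists (t * s); first by rewrite /= mulr_ge0.
  rewrite rmorphM -scalerA -scalerDr sublinearZ//; lra.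
split=> //.
  by move=> v; have := shle 0 v (lexx _); rewrite scale0r addr0 mul0r subr0.
have := shle 1 (- y) ler01.
by rewrite scale1r addNr sublinear0// mul1r sub0r.
Qed.

(** Zorn's lemma for the reversed pointwise order. A nonempty chain is bounded by its pointwise
    infimum, which is finite because every member is at least [- p (- v)]; the empty chain is
    bounded by [p] itself. *)
Lemma minimal_sublinear p : sublinear p ->
  exists q, [/\ sublinear q, forall v, q v <= p v &
    forall q', sublinear q' -> (forall v, q' v <= q v) -> q' = q].
Proof.
move=> sp; pose T := {q : V -> R | sublinear q /\ forall v, q v <= p v}.
pose ord (a b : T) := `[< forall v, sval b v <= sval a v >].
have [||||[q [sq qp]] qmin] := @Zorn T ord.
- by move=> t; apply/asboolP.
- by move=> r s t /asboolP rs /asboolP st; apply/asboolP => v; exact: le_trans (st v) (rs v).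
- move=> [s Hs] [t Ht] /asboolP/= st /asboolP/= ts; apply: eq_exist.
  by apply/funext => v; apply/eqP; rewrite eq_le ts st.
- move=> C Ctot; have [[a0 Ca0]|C0] := pselect (exists a, C a); last first.
    by exists (exist _ p (conj sp (fun v => lexx _))) => s Cs; case: C0; exists s.
  have [|[a [sa ap]] v Ca /=|a b x y Ca Cb|[a [sa ap]] t x Ca t0|slin shle] :=
    @inf_sublinear T C (fun a => sval a) a0 (fun v => - p (- v)).
  + exact: Ca0.
  + by apply: le_trans (sublinear_ge v sa); rewrite lerN2.
  + case: (Ctot a b Ca Cb) => /asboolP ab.
      exists b => //; apply: (le_trans ((svalP b).1.1 _ _)); rewrite lerD2r; exact: ab.
    exists a => //; apply: (le_trans ((svalP a).1.1 _ _)); rewrite lerD2l; exact: ab.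
  + by exists (exist _ a (conj sa ap)) => //=; exact: sa.2.
  + have slp v : inf [set sval a v | a in C] <= p v.
      by apply: le_trans (shle a0 v Ca0) _; exact: (svalP a0).2.
    exists (exist _ (fun v => inf [set sval a v | a in C]) (conj slin slp)) => s Cs.
    by apply/asboolP => v /=; exact: shle.
exists q; split=> // q' sq' q'q.
have q'p v : q' v <= p v by apply: le_trans (q'q v) (qp v).
have /(_ _)/(congr1 sval) := qmin (exist _ q' (conj sq' q'p)).
by apply; apply/asboolP.
Qed.

(** The minimal functional is taken below [shave p x] rather than below [p]: then
    [g (- x) <= - p x], and oddness of [g] gives [g x = p x]. *)
Lemma real_hahn_banach p x : sublinear p ->
  exists g : V -> R, [/\ forall u v, g (u + v) = g u + g v,
    forall t v, g (t%:C *: v) = t * g v, forall v, g v <= p v & g x = p x].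
Proof.
move=> sp; have [sps psp pxs] := shave_sublinear x sp.
have [g [sg gs gmin]] := minimal_sublinear sps.
have gN y : g (- y) = - g y.
  have [sgs gsg gys] := shave_sublinear y sg.
  (* By minimality [shave g y = g], so the value of [shave g y] at [- y] bounds [g (- y)] by
     [- g y]. *)
  apply/eqP; rewrite eq_le -{1}(gmin _ sgs gsg) gys/=.
  by rewrite lerNl sublinear_ge.
have gD u v : g (u + v) = g u + g v.
  apply/eqP; rewrite eq_le sg.1/= -lerN2 -gN !opprD -!gN.
  exact: sg.1.
exists g; split=> //.
- move=> t v; have [t0|t0] := leP 0 t; first exact: sublinearZ.
  by rewrite -[t]opprK rmorphN scaleNr gN mulNr sublinearZ// oppr_ge0 ltW.
- by move=> v; exact: le_trans (gs v) (psp v).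
- apply/eqP; rewrite eq_le (le_trans (gs x) (psp x))/= -lerN2 -gN.
  exact: le_trans (gs _) pxs.
Qed.

(** The distance to [W] measured by [N] is sublinear. If it vanishes at [x], then [W] approximates
    [x]; otherwise a real functional dominated by it is zero on [W] and positive at [x], and is then
    complexified. *)
Lemma complex_hahn_banach (N : V -> R[i]) W x :
  (forall u v, N (u + v) <= N u + N v) ->
  (forall k v, N (k *: v) = `|k| * N v) ->
  W 0 -> (forall k u v, W u -> W v -> W (k *: u + v)) ->
  (forall e, 0 < e -> exists2 w, W w & N (w - x) <= e) \/
  exists G : V -> R[i], [/\ forall k u v, G (k *: u + v) = k * G u + G v,
    forall v, `|G v| <= 2 * N v, forall w, W w -> G w = 0 & G x != 0].
Proof.
move=> ND NZ W0 Wlin.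
have N0 : N 0 = 0 by rewrite -(scale0r 0) NZ normr0 mul0r.
have NN v : N (- v) = N v by rewrite -scaleN1r NZ normrN1 mul1r.
have N_ge0 v : 0 <= N v.
  have := ND v (- v); rewrite subrr N0 NN -mulr2n -mulr_natr => h.
  by rewrite -(@pmulr_lge0 _ 2%:R)// ltr0n.
have NRe v : N v = (complex.Re (N v))%:C by rewrite RRe_real// ger0_real.
have ReN_ge0 v : 0 <= complex.Re (N v) by rewrite -ler0c -NRe.
have WZ k w : W w -> W (k *: w) by move=> Ww; rewrite -[k *: w]addr0; exact: Wlin.
have WD u v : W u -> W v -> W (u + v).
  by move=> Wu Wv; rewrite -[u]scale1r; exact: Wlin.
have [|w v Ww|i j y z Wi Wj|i t y Wi t0|sp pN] :=
    @inf_sublinear V W (fun w v => complex.Re (N (v - w))) 0 (fun=> 0).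
- exact: W0.
- exact: ReN_ge0.
- exists (i + j); first exact: WD.
  rewrite -lecR rmorphD /= -!NRe.
  by rewrite opprD addrACA; exact: ND.
- exists (t%:C *: i); first exact: WZ.
  rewrite -lecR rmorphM /= -!NRe -scalerBr NZ.
  by rewrite ger0_norm// ler0c.
set p := fun v => _ in sp.
have pN0 v : p v <= complex.Re (N v) by have := pN 0 v W0; rewrite subr0.
have [px|px] := leP (p x) 0.
  left=> e e0.
  have : inf [set complex.Re (N (x - w)) | w in W] < complex.Re e.
    by apply: le_lt_trans px _; move: e0; rewrite ltcE => /andP[].
  move=> /inf_lt[|_ [w Ww <-] Nwe].
    by exists (complex.Re (N (x - 0))); exists 0.
  exists w => //; rewrite -opprB NN NRe -(RRe_real (gtr0_real e0)) lecR.
  exact: ltW.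
right; have [g [gD gZ gp gx]] := real_hahn_banach x sp.
have gN v : g (- v) = - g v.
  by have := gZ (-1) v; rewrite rmorphN scaleN1r mulN1r.
have g_le v : `|g v| <= complex.Re (N v).
  rewrite ler_norml lerNl -gN -{1}NN; apply/andP.
  by split; exact: le_trans (gp _) (pN0 _).
have gW w : W w -> g w = 0.
  have gle0 u : W u -> g u <= 0.
    move=> Wu; apply: le_trans (gp u) _; apply: le_trans (pN u u Wu) _.
    by rewrite subrr N0.
  move=> Ww; apply/eqP; rewrite eq_le gle0//= -lerN2 oppr0 -gN gle0//.
  by rewrite -scaleN1r; exact: WZ.
(* The complex linear functional with real part [g]. *)
pose G v := g v +i* - g ('i%C *: v).
exists G; split.
- move=> k u v; rewrite /G !(scalerDr, gD).
  have gk y : g (k *: y) = complex.Re k * g y + complex.Im k * g ('i%C *: y).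
    by rewrite {1}(complexE k) scalerDl gD gZ ['i%C * _]mulrC -scalerA gZ.
  have -> : 'i%C *: (k *: u) = k *: ('i%C *: u) by rewrite !scalerA mulrC.
  rewrite !gk scalerA -expr2 sqr_i scaleN1r gN.
  apply/eqP; rewrite eq_complex; case: k {gk} => a b /=.
  by apply/andP; split; apply/eqP; lra.
(* Real and imaginary parts are each bounded by [N v]; adding them costs the factor 2. *)
- move=> v; rewrite /G.
  have -> : g v +i* - g ('i%C *: v) = (g v)%:C - 'i%C * (g ('i%C *: v))%:C.
    by apply/eqP; rewrite eq_complex /=; apply/andP; split; apply/eqP; lra.
  rewrite (le_trans (ler_normB _ _))// normrM mulr2n mulrDl mul1r.
  rewrite normci mul1r !normcR; apply: lerD; first by rewrite NRe lecR.
  by rewrite -[leRHS]mul1r -normci -NZ [leRHS]NRe lecR.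
- move=> w Ww; rewrite /G gW// gW ?oppr0//; exact: WZ.
- apply/eqP => /(congr1 (@complex.Re R)) /= gx0; move: px; rewrite -gx gx0 ltxx//.
Qed.

End HahnBanach.

(** * Separation in a finite power of a normed space *)

Section FiniteHahnBanach.
Context {R : realType} {A : normedModType R[i]} {n : nat}.

(** Complex Hahn-Banach for the sum norm [N], which dominates every coordinate. The [phi k] are the
    compositions of the separating functional with the coordinate inclusions [io k]. *)
Lemma finite_hahn_banach (W : set {ffun 'I_n -> A}) (x : {ffun 'I_n -> A}) :
  W 0 -> (forall k u v, W u -> W v -> W (k *: u + v)) ->
  (forall e : R[i], 0 < e -> exists2 v, W v & forall k, `|v k - x k| <= e) \/
  exists phi : 'I_n -> A -> R[i], [/\ forall k, in_dual (phi k),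
    forall v, W v -> \sum_k phi k (v k) = 0 & \sum_k phi k (x k) != 0].
Proof.
move=> W0 Wlin; pose N (v : {ffun 'I_n -> A}) : R[i] := \sum_k `|v k|.
have ND u v : N (u + v) <= N u + N v.
  by rewrite -big_split; apply: ler_sum => k _; rewrite ffunE ler_normD.
have NZ k v : N (k *: v) = `|k| * N v.
  by rewrite mulr_sumr; apply: eq_bigr => j _; rewrite ffunE normrZ.
have [appr|[G [Glin Gle GW Gx]]] := complex_hahn_banach x ND NZ W0 Wlin.
  left=> e /appr[v Wv Nv]; exists v => // k; apply: le_trans Nv.
  have := @ler_sum _ _ (index_enum 'I_n) xpredT (fun j => if j == k then `|v j - x j| else 0)
    (fun j => `|v j - x j|).
  rewrite -big_mkcond big_pred1_eq /N => /(_ _)/le_trans; apply.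
    by move=> i _; case: ifP.
  by apply: ler_sum => j _; rewrite !ffunE.
right; pose io (k : 'I_n) (a : A) : {ffun 'I_n -> A} := [ffun j => if j == k then a else 0].
have G0 : G 0 = 0 by exact: GW.
have GD u v : G (u + v) = G u + G v by rewrite -[u]scale1r Glin mul1r scale1r.
have Gsum (v : {ffun 'I_n -> A}) : \sum_k G (io k (v k)) = G v.
  rewrite -(big_morph G GD G0); congr G; apply/ffunP => j; rewrite sum_ffunE.
  rewrite (bigD1 j)//= ffunE eqxx big1 ?addr0// => i ij.
  by rewrite ffunE eq_sym (negbTE ij).
exists (fun k a => G (io k a)); split.
- move=> k; split=> [c a b|].
    rewrite -Glin; congr G; apply/ffunP => j; rewrite !ffunE.
    by case: ifP => // _; rewrite scaler0 addr0.
  exists 2 => a; apply: le_trans (Gle _) _; rewrite ler_pM2l ?ltr0n//.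
  rewrite /N (bigD1 k)//= ffunE eqxx big1 ?addr0// => i ik.
  by rewrite ffunE (negbTE ik) normr0.
- by move=> v Wv; rewrite Gsum GW.
- by rewrite Gsum.
Qed.

End FiniteHahnBanach.

(** * Completeness of the complex numbers and Banach spaces of weighted functions *)

Lemma complex_filter_complete (R : realType) (U : Type) (F : set_system U)
    (FF : ProperFilter F) (h : U -> R[i]) :
  (forall e : R[i], 0 < e -> exists a : R[i], F [set x | `|a - h x| <= e]) ->
  exists z : R[i], forall e : R[i], 0 < e -> F [set x | `|z - h x| <= e].
Proof.
move=> Fc.
have part (p : R[i] -> R) : (forall a b, p (a - b) = p a - p b) ->
    (forall a, `|p a|%:C <= `|a|) ->
    exists l, forall e : R, 0 < e -> F [set x | `|l - p (h x)| <= e].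
  move=> pB ple; have /cauchy_cvg/cvg_ex[l] : cauchy ((p \o h) @ F).
    apply/cauchyP => e e0; have [|a Fa] := Fc (e / 2)%:C.
      by rewrite ltcR divr_gt0.
    exists (p a); rewrite /=; apply: filterS Fa => x /= ax.
    rewrite -ball_normE /= -ltcR -pB (le_lt_trans (ple _))// (le_lt_trans ax)//.
    by rewrite ltcR ltr_pdivrMr// ltr_pMr// ltr1n.
  by move=> /cvgrPdist_le lP; exists l => e /lP.
have [||a aP] := part (@complex.Re R).
- by move=> [? ?] [? ?].
- exact: normc_ge_Re.
have [||b bP] := part (@complex.Im R).
- by move=> [? ?] [? ?].
(* Multiplication by [-i] turns the imaginary part into the real part and keeps the modulus. *)
- move=> [x y]; have := normc_ge_Re (y +i* (-x)).
  by rewrite !normc_def /= sqrrN addrC.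
exists (a +i* b) => e e0; rewrite -(ReK (ltW e0)).
have e20 : 0 < complex.Re e / 2.
  by rewrite divr_gt0 ?ltr0n// -ltcR ReK ?(ltW e0).
apply: filterS2 (aP _ e20) (bP _ e20) => x /=; case: (h x) => c d /= ac bd.
have -> : a +i* b - (c +i* d) = (a - c)%:C + 'i%C * (b - d)%:C.
  by apply/eqP; rewrite eq_complex /=; apply/andP; split; apply/eqP; lra.
rewrite (le_trans (ler_normD _ _))// normrM normcR normci mul1r normcR.
by rewrite -rmorphD lecR; move: ac bd; lra.
Qed.

(* The Banach space of functions [f] on [T] with [|f t| <= M * |w t|] for some
   [M], subject to the linear relations [f t0 = k * f t1 + f t2] listed in
   [rel]. It plays the role of the dual of the space presented by generators
   [T] of norm at most [|w t|] and relations [rel]. *)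
Section WSpace.
Context {R : realType} {T : Type}.
Variables (w : T -> R[i]) (rel : T -> R[i] -> T -> T -> Prop).

Definition wpred : {pred T -> R[i]} := fun g =>
  `[< (exists2 M : R, 0 <= M & forall t, `|g t| <= M%:C * `|w t|) /\
      forall t0 k t1 t2, rel t0 k t1 t2 -> g t0 = k * g t1 + g t2 >].

Lemma wpred_submod_closed : submod_closed wpred.
Proof.
split=> [|c f g /asboolP[[M M0 fM] fr] /asboolP[[L L0 gL] gr]]; apply/asboolP.
  split; first by exists 0 => // t; rewrite normr0 mul0r.
  by move=> *; rewrite mulr0 addr0.
have cfg t : (c *: f + g) t = (c : R[i]) * f t + g t by [].
split.
  exists (complex.Re (`|c : R[i]|) * M + L) => [|t].
    by rewrite addr_ge0 ?mulr_ge0// Re_ge0.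
  rewrite cfg (le_trans (ler_normD _ _))// rmorphD mulrDl lerD//.
  rewrite normrM rmorphM -mulrA; apply: ler_pM => //.
move=> t0 k t1 t2 r; rewrite !cfg (fr _ _ _ _ r) (gr _ _ _ _ r).
by rewrite !mulrDr addrACA !mulrA [c * k]mulrC.
Qed.

HB.instance Definition _ := GRing.isSubmodClosed.Build R[i] (T -> R[i]) wpred wpred_submod_closed.

Record wspace := WSpace { wfun :> T -> R[i]; _ : wfun \in wpred }.
HB.instance Definition _ := [isSub for wfun].
HB.instance Definition _ := [Choice of wspace by <:].
HB.instance Definition _ := [SubChoice_isSubLmodule of wspace by <:].

Implicit Types f g : wspace.

Lemma wfun_inj f g : (forall t, f t = g t) -> f = g.
Proof. by move=> fg; apply/val_inj/funext. Qed.

Lemma wfunP (f : wspace) :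
  (exists2 M : R, 0 <= M & forall t, `|f t| <= M%:C * `|w t|) /\
  forall t0 k t1 t2, rel t0 k t1 t2 -> f t0 = k * f t1 + f t2.
Proof. by case: f => f /= /asboolP. Qed.

Lemma wfun_rel (f : wspace) t0 k t1 t2 :
  rel t0 k t1 t2 -> f t0 = k * f t1 + f t2.
Proof. exact: (wfunP f).2. Qed.

Lemma wfun_lin (f g : wspace) (c : R[i]) t : (c *: f + g) t = c * f t + g t.
Proof. by []. Qed.

Definition wnorm (f : wspace) : R[i] :=
  (inf [set M : R | 0 <= M /\ forall t, `|f t| <= M%:C * `|w t|])%:C.

Lemma wnorm_ge0 f : 0 <= wnorm f.
Proof.
rewrite ler0c; apply: lb_le_inf; last by move=> M [].
by have [[M M0 fM] _] := wfunP f; exists M.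
Qed.

Lemma wnorm_le f (M : R[i]) : 0 <= M ->
  (forall t, `|f t| <= M * `|w t|) -> wnorm f <= M.
Proof.
move=> M0 fM; rewrite -(ReK M0) lecR; apply: ge_inf; first by exists 0 => L [].
by split=> [|t]; [exact: Re_ge0|rewrite ReK].
Qed.

(** The infimum is attained: for fixed [t] divide by the weight, and where the weight is zero [f]
    vanishes. *)
Lemma wfun_le f t : `|f t| <= wnorm f * `|w t|.
Proof.
have [[M M0 fM] _] := wfunP f.
have [w0|w0] := eqVneq (w t) 0.
  by have := fM t; rewrite w0 normr0 !mulr0.
have w_gt0 : 0 < `|w t| by rewrite normr_gt0.
rewrite -ler_pdivrMr// -(ReK (divr_ge0 (normr_ge0 (f t)) (normr_ge0 (w t)))) lecR.
apply: lb_le_inf; first by exists M.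
move=> L [L0 fL]; rewrite -lecR ReK ?divr_ge0//.
by rewrite ler_pdivrMr.
Qed.

Lemma wnormD f g : wnorm (f + g) <= wnorm f + wnorm g.
Proof.
apply: wnorm_le => [|t]; first by rewrite addr_ge0 ?wnorm_ge0.
by rewrite mulrDl (le_trans (ler_normD _ _))// lerD ?wfun_le.
Qed.

Lemma wnormZ_le (c : R[i]) f : wnorm (c *: f) <= `|c| * wnorm f.
Proof.
apply: wnorm_le => [|t]; first by rewrite mulr_ge0 ?wnorm_ge0.
by rewrite -mulrA [X in `|X|](_ : _ = c * f t)// normrM ler_wpM2l ?wfun_le.
Qed.

Lemma wnormZ (c : R[i]) f : wnorm (c *: f) = `|c| * wnorm f.
Proof.
have [->|c0] := eqVneq c 0.
  rewrite scale0r normr0 mul0r; apply/eqP; rewrite eq_le wnorm_ge0 andbT.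
  by apply: wnorm_le => // t; rewrite normr0 mul0r.
apply/eqP; rewrite eq_le wnormZ_le/= -ler_pdivlMl ?normr_gt0//.
by rewrite -normfV -{1}[f]scale1r -(mulVf c0) -scalerA wnormZ_le.
Qed.

Lemma wnorm0_eq0 f : wnorm f = 0 -> f = 0.
Proof.
move=> f0; apply: wfun_inj => t; apply/eqP; rewrite -normr_le0.
by have := wfun_le f t; rewrite f0 mul0r.
Qed.

HB.instance Definition _ :=
  Lmodule_isNormed.Build R[i] wspace wnormD wnormZ wnorm0_eq0.

Lemma wnormE f : `|f| = wnorm f. Proof. by []. Qed.

(** The limit is taken pointwise; weighted bounds and linear relations both survive pointwise
    limits. *)
Lemma wspace_complete (F : set_system wspace) :
  ProperFilter F -> cauchy F -> cvg F.
Proof.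
move=> FF /cauchyP Fc; apply/cvg_ex.
have Fc' e : 0 < e -> exists2 f, F (ball f e) &
    forall g t, ball f e g -> `|f t - g t| <= e * `|w t|.
  move=> e0; have [f Ff] := Fc e e0; exists f => // g t.
  rewrite -ball_normE /= => /ltW fge.
  by apply: le_trans (wfun_le (f - g) t) _; rewrite ler_wpM2r.
have /choice[z zP] t : exists z : R[i], forall e, 0 < e -> F [set g : wspace | `|z - g t| <= e].
  apply: complex_filter_complete => e e0.
  (* With this radius the error at [t] is at most [e], even if [w t = 0]. *)
  have [f Ff fg] := Fc' (e / (1 + `|w t|)) (divr_gt0 e0 (ltr_wpDr (normr_ge0 _) ltr01)).
  exists (f t); apply: filterS Ff => g /fg/le_trans; apply.
  by rewrite -mulrA ler_piMr ?(ltW e0)// mulrC ler_pdivrMr ?mul1r ?lerDr// ltr_wpDr.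
have near_z c f t : F [set g : wspace | `|f t - g t| <= c] -> `|f t - z t| <= c.
  move=> Fg; have [g0] := filter_ex Fg; move=> /(le_trans (normr_ge0 _)) c0.
  apply/ler_addgt0Pr => e e0; have [g [/= fg zg]] := filter_ex (filterI Fg (zP t e e0)).
  by rewrite (le_trans (ler_distD (g t) _ _))// lerD// distrC.
have zpred : z \in wpred.
  apply/asboolP; split.
    have [f Ff fg] := Fc' 1 ltr01.
    exists (1 + complex.Re (wnorm f)) => [|t].
      by rewrite addr_ge0// Re_ge0 ?wnorm_ge0.
    rewrite (_ : _%:C = 1 + wnorm f); last by rewrite rmorphD.
    rewrite mulrDl -[z t](subrK (f t)).
    rewrite (le_trans (ler_normD _ _))// lerD ?wfun_le// distrC.
    by apply: near_z; apply: filterS Ff => g; exact: fg.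
  move=> t0 k t1 t2 r.
  have cvgz t : (fun g : wspace => g t : R[i]^o) @ F --> (z t : R[i]^o).
    by apply/cvgrPdist_le => e e0; exact: zP.
  (* Both sides of the relation converge along [F], and limits are unique. *)
  apply: (cvg_unique (@norm_hausdorff _ R[i]^o) (cvgz t0)).
  have -> : (fun g : wspace => g t0 : R[i]^o) =
      (fun g : wspace => (k : R[i]^o) * (g t1 : R[i]^o) + (g t2 : R[i]^o)).
    by apply/funext => g; exact: wfun_rel r.
  by apply: cvgD; [apply: cvgMl_tmp|]; exact: cvgz.
exists (WSpace zpred); apply/cvgrPdist_le => /= e e0.
have e20 : 0 < e / 2 by rewrite divr_gt0// ltr0n.
have [f Ff fg] := Fc' (e / 2) e20.
apply: filterS (Ff) => g fge; rewrite wnormE; apply: wnorm_le => [|t]; first exact: ltW.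
rewrite [X in `|X|](_ : _ = z t - g t)//.
rewrite (le_trans (ler_distD (f t) _ _))// [e in leRHS]splitr mulrDl lerD//; last exact: fg.
rewrite distrC; apply: near_z; apply: filterS Ff => h; exact: fg.
Qed.

HB.instance Definition _ := Uniform_isComplete.Build wspace wspace_complete.

End WSpace.

Section WComp.
Context {R : realType} {T : Type}.
Variables (w : T -> R[i]) (rel : T -> R[i] -> T -> T -> Prop).
Variables (s : T -> T) (c : R[i]).
Hypothesis c_ge0 : 0 <= c.
Hypothesis sw : forall t, `|w (s t)| <= c * `|w t|.
Hypothesis srel : forall t0 k t1 t2, rel t0 k t1 t2 -> rel (s t0) k (s t1) (s t2).
Implicit Type f : wspace w rel.

Lemma wcomp_le f t : `|f (s t)| <= c * wnorm f * `|w t|.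
Proof.
by rewrite (le_trans (wfun_le f _))// mulrC mulrAC ler_wpM2r ?wnorm_ge0.
Qed.

Lemma wcomp_wpred f : f \o s \in wpred w rel.
Proof.
apply/asboolP; split=> [|t0 k t1 t2 r]; last exact/wfun_rel/srel.
exists (complex.Re (c * wnorm f)) => [|t]; first by rewrite Re_ge0 ?mulr_ge0 ?wnorm_ge0.
by rewrite ReK ?mulr_ge0 ?wnorm_ge0//; exact: wcomp_le.
Qed.

(** The transpose of a map of generators; both module actions below have this form. *)
Definition wcomp f : wspace w rel := WSpace (wcomp_wpred f).

Lemma wcomp_norm_le f : `|wcomp f| <= c * `|f|.
Proof.
by rewrite !wnormE; apply: wnorm_le => [|t]; [rewrite mulr_ge0 ?wnorm_ge0|exact: wcomp_le].
Qed.

End WComp.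

Lemma directed_finite_ub (I : directed_set) n (i0 : 'I_n -> I) :
  exists i, forall k, dle (i0 k) i.
Proof.
elim: n i0 => [|n IH] i0; first by have [j] := dI_inhabited I; exists j => -[].
have [i iP] := IH (fun k => i0 (lift ord0 k)).
have [j [i0j ij]] := dI_directed (i0 ord0) i.
exists j => k; case: (unliftP ord0 k) => [l ->|->//].
exact: dle_trans (iP l) ij.
Qed.

(** * The unitization, the universal bimodule and its derivation *)

Section Derivation.
Context {R : realType} {A : completeNormedModType R[i]} {m : A -> A -> A}.
Hypothesis Balg : is_banach_algebra m.
Implicit Types (a b c : A) (p q : A * R[i]).

Let mA a b c : m (m a b) c = m a (m b c). Proof. by case: Balg. Qed.
Let mlinl (k : R[i]) a b c : m (k *: a + b) c = k *: m a c + m b c. Proof. by case: Balg. Qed.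
Let mlinr (k : R[i]) a b c : m a (k *: b + c) = k *: m a b + m a c. Proof. by case: Balg. Qed.
Let mnorm a b : `|m a b| <= `|a| * `|b|. Proof. by case: Balg. Qed.
Let m0l a : m 0 a = 0.
Proof. by have := mlinl (-1) 0 0 a; rewrite scaler0 addr0 scaleN1r addNr. Qed.
Let m0r a : m a 0 = 0.
Proof. by have := mlinr (-1) a 0 0; rewrite scaler0 addr0 scaleN1r addNr. Qed.
Let mZl k a b : m (k *: a) b = k *: m a b.
Proof. by rewrite -[k *: a]addr0 mlinl m0l addr0. Qed.
Let mZr k a b : m a (k *: b) = k *: m a b.
Proof. by rewrite -[k *: b]addr0 mlinr m0r addr0. Qed.
Let mDl a b c : m (a + b) c = m a c + m b c.
Proof. by rewrite -[a]scale1r mlinl !scale1r. Qed.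
Let mDr a b c : m a (b + c) = m a b + m a c.
Proof. by rewrite -[b]scale1r mlinr !scale1r. Qed.
Let mBr a b c : m a (b - c) = m a b - m a c.
Proof. by rewrite mDr -scaleN1r mZr scaleN1r. Qed.

(* [A * R[i]] is the unitization of [A]: [(a, k)] stands for [a + k 1]. *)
Definition lact p a : A := m p.1 a + p.2 *: a.
Definition ract a p : A := m a p.1 + p.2 *: a.
Definition uemb a : A * R[i] := (a, 0).

Lemma lact_linr k p a b : lact p (k *: a + b) = k *: lact p a + lact p b.
Proof.
by rewrite /lact mlinr !scalerDr !scalerA [k * _]mulrC addrACA.
Qed.

Lemma lact_linl k p q a : lact (k *: p + q) a = k *: lact p a + lact q a.
Proof. by rewrite /lact /= mlinl !scalerDl scalerDr scalerA addrACA. Qed.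

Lemma ract_linl k p a b : ract (k *: a + b) p = k *: ract a p + ract b p.
Proof.
by rewrite /ract mlinl !scalerDr !scalerA [k * _]mulrC addrACA.
Qed.

Lemma ract_linr k p q a : ract a (k *: p + q) = k *: ract a p + ract a q.
Proof. by rewrite /ract /= mlinr !scalerDl scalerDr scalerA addrACA. Qed.

Lemma lactM p a b : lact p (m a b) = m (lact p a) b.
Proof. by rewrite /lact mDl mA mZl. Qed.

Lemma ractM p a b : ract (m a b) p = m a (ract b p).
Proof. by rewrite /ract mDr mA mZr. Qed.

Lemma lact_uemb a b : lact (uemb a) b = m a b.
Proof. by rewrite /lact /= scale0r addr0. Qed.

Lemma ract_uemb a b : ract a (uemb b) = m a b.
Proof. by rewrite /ract /= scale0r addr0. Qed.

(** Associativity with an element of the unitization in the middle; it makes both shifts of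
    generators respect the Leibniz relation. *)
Lemma mul_ract_lact a p b : m (ract a p) b = m a (lact p b).
Proof. by rewrite /ract /lact mDl mDr mA mZl mZr. Qed.

Lemma uemb_lin k a b : uemb (k *: a + b) = k *: uemb a + uemb b.
Proof. by rewrite /uemb /=; congr pair; rewrite /= scaler0 addr0. Qed.

Definition unorm p : R[i] := `|p.1| + `|p.2|.

Lemma unorm_ge0 p : 0 <= unorm p. Proof. by rewrite addr_ge0. Qed.

Lemma lact_le p a : `|lact p a| <= unorm p * `|a|.
Proof.
by rewrite (le_trans (ler_normD _ _))// mulrDl lerD// normrZ.
Qed.

Lemma ract_le p a : `|ract a p| <= `|a| * unorm p.
Proof.
by rewrite (le_trans (ler_normD _ _))// mulrDr lerD// normrZ mulrC.
Qed.

Lemma unorm_emb a : unorm (uemb a) = `|a|. Proof. by rewrite /unorm /= normr0 addr0. Qed.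

(* [(p, c, q)] stands for the element [p . d c . q] of the bimodule generated
   by a universal derivation [d] on [A], with [p] and [q] in the unitization. *)
Let T : Type := ((A * R[i]) * A * (A * R[i]))%type.

(** Trilinearity, and the Leibniz rule for [d (c c')] multiplied by [p] on the left and by [q] on
    the right. *)
Inductive der_rel : T -> R[i] -> T -> T -> Prop :=
| DerLinL k p p' c q : der_rel (k *: p + p', c, q) k (p, c, q) (p', c, q)
| DerLinM k p c c' q : der_rel (p, k *: c + c', q) k (p, c, q) (p, c', q)
| DerLinR k p c q q' : der_rel (p, c, k *: q + q') k (p, c, q) (p, c, q')
| DerLeibniz p c c' q :
    der_rel (p, m c c', q) 1 (uemb (lact p c), c', q) (p, c, uemb (ract c' q)).

Definition der_weight (t : T) : R[i] := unorm t.1.1 * `|t.1.2| * unorm t.2.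

Lemma der_weight_norm t : `|der_weight t| = der_weight t.
Proof. by rewrite ger0_norm// !mulr_ge0 ?unorm_ge0. Qed.

(** Right multiplication of a generator by [a]; its transpose is the left action on forms.
    Symmetrically for [der_shr]. *)
Definition der_shl a (t : T) : T := (t.1, uemb (lact t.2 a)).
Definition der_shr a (t : T) : T := (uemb (ract a t.1.1), t.1.2, t.2).

Lemma der_shl_weight a t : `|der_weight (der_shl a t)| <= `|a| * `|der_weight t|.
Proof.
rewrite !der_weight_norm /der_weight /= mulrCA ler_wpM2l ?mulr_ge0 ?unorm_ge0//.
by rewrite unorm_emb mulrC lact_le.
Qed.

Lemma der_shr_weight a t : `|der_weight (der_shr a t)| <= `|a| * `|der_weight t|.
Proof.
rewrite !der_weight_norm /der_weight /= !mulrA ler_wpM2r ?unorm_ge0//.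
by rewrite ler_wpM2r// unorm_emb ract_le.
Qed.

Lemma der_shl_rel a t0 k t1 t2 : der_rel t0 k t1 t2 ->
  der_rel (der_shl a t0) k (der_shl a t1) (der_shl a t2).
Proof.
case=> {t0 k t1 t2} *; rewrite /der_shl /=; try by constructor.
- by rewrite lact_linl uemb_lin; constructor.
- by rewrite lact_uemb mul_ract_lact -[m _ (lact _ _)]ract_uemb; constructor.
Qed.

Lemma der_shr_rel a t0 k t1 t2 : der_rel t0 k t1 t2 ->
  der_rel (der_shr a t0) k (der_shr a t1) (der_shr a t2).
Proof.
case=> {t0 k t1 t2} *; rewrite /der_shr /=; try by constructor.
- by rewrite ract_linr uemb_lin; constructor.
- by rewrite ract_uemb -mul_ract_lact -[m (ract _ _) _]lact_uemb; constructor.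
Qed.

Definition der_space := wspace der_weight der_rel.

Definition der_la a (g : der_space) : der_space :=
  wcomp (normr_ge0 a) (der_shl_weight a) (@der_shl_rel a) g.
Definition der_ra (g : der_space) a : der_space :=
  wcomp (normr_ge0 a) (der_shr_weight a) (@der_shr_rel a) g.

Lemma der_bimodule : is_banach_bimodule m der_la der_ra.
Proof.
split; [|split; [|split; [|split; [|split; [|split; [|split; [|split]]]]]]].
- move=> k a b g; apply: wfun_inj => -[[p c] q].
  (* Linearity in the algebra variable is the linearity of the form [g] in its last slot. *)
  rewrite wfun_lin /= /der_shl /= lact_linr uemb_lin; apply: wfun_rel; constructor.
- by move=> k a g h; apply: wfun_inj.
- move=> k a b g; apply: wfun_inj => -[[p c] q].
  rewrite wfun_lin /= /der_shr /= ract_linl uemb_lin; apply: wfun_rel; constructor.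
- by move=> k a g h; apply: wfun_inj.
- move=> a b g; apply: wfun_inj => -[[p c] q].
  by rewrite /= /der_shl /= lactM lact_uemb.
- move=> a b g; apply: wfun_inj => -[[p c] q].
  by rewrite /= /der_shr /= ractM ract_uemb.
- by move=> a b g; apply: wfun_inj.
- by move=> a g; exact: wcomp_norm_le.
- by move=> a g; exact: wcomp_norm_le.
Qed.

Let one : A * R[i] := (0, 1).

Definition der_univ a (g : der_space) : R[i] := g (one, a, one).

Let unorm_one : unorm one = 1. Proof. by rewrite /unorm /= normr0 add0r normr1. Qed.

Lemma der_univ_le a g : `|der_univ a g| <= `|a| * `|g|.
Proof.
apply: le_trans (wfun_le g _) _.
by rewrite der_weight_norm /der_weight /= unorm_one mul1r mulr1 mulrC.
Qed.

Lemma der_univ_cont_derivation : is_cont_derivation m der_la der_ra der_univ.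
Proof.
split.
- by move=> a; split=> //; exists `|a| => g; exact: der_univ_le.
- by move=> k a b g; apply: wfun_rel; constructor.
(* The Leibniz relation at [p = q = 1] is the derivation rule. *)
- move=> a b g; rewrite /der_univ (wfun_rel _ (DerLeibniz _ _ _ _)) mul1r.
  by rewrite /dual_lact /dual_ract /= /der_shl /der_shr /= /lact /ract /= !m0l !m0r.
- by exists 1 => a g; rewrite mul1r der_univ_le.
Qed.

(** * Test forms built from the projection, and approximate units for finite sets *)

Section Defect.
Variables (J : set A) (P : A -> A) (C : R[i]).
Hypothesis J0 : J 0.
Hypothesis Jlin : forall (k : R[i]) x y, J x -> J y -> J (k *: x + y).
Hypothesis Jm : forall a x, J x -> J (m a x) /\ J (m x a).
Hypothesis Plin : forall (k : R[i]) x y, P (k *: x + y) = k *: P x + P y.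
Hypothesis PC : forall x, `|P x| <= C * `|x|.
Hypothesis PJ : forall x, J (P x).
Hypothesis Pid : forall x, J x -> P x = x.

Let P0 : P 0 = 0. Proof. exact: Pid. Qed.
Let JZ k x : J x -> J (k *: x).
Proof. by move=> Jx; rewrite -[_ *: _]addr0; exact: Jlin. Qed.
Let JD x y : J x -> J y -> J (x + y).
Proof. by move=> Jx Jy; rewrite -[x]scale1r; exact: Jlin. Qed.
Let Jlact p a : J a -> J (lact p a).
Proof. by move=> Ja; apply: JD; [exact: (Jm p.1 Ja).1|exact: JZ]. Qed.

(* The defect of [P], extended by [P 1 = 0], from being a left module map. *)
Definition defect a q : A := m a (P q.1) - P (ract a q).

Lemma defect_linl k a b q :
  defect (k *: a + b) q = k *: defect a q + defect b q.
Proof. by rewrite /defect mlinl ract_linl Plin opprD scalerBr addrACA. Qed.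

Lemma defect_linr k a p q :
  defect a (k *: p + q) = k *: defect a p + defect a q.
Proof. by rewrite /defect ract_linr /= !Plin mlinr opprD scalerBr addrACA. Qed.

(** The defect is the commutator of left multiplication by [a] with [P], and commutators obey the
    Leibniz rule. *)
Lemma defectM a b q :
  defect (m a b) q = m a (defect b q) + defect a (uemb (ract b q)).
Proof.
by rewrite /defect ract_uemb ractM /= mBr mA addrA subrK.
Qed.

(** This makes [lact p (defect c q)] a candidate right unit in [J], to which the separating
    functionals can be applied. *)
Lemma defect_J a q : J (defect a q).
Proof.
by rewrite /defect -scaleN1r; apply: JD; [exact: (Jm a (PJ _)).1|exact: JZ].
Qed.

Lemma defect_uemb a x : J x -> defect a (uemb x) = 0.
Proof. by move=> Jx; rewrite /defect ract_uemb /= !Pid ?subrr//; exact: (Jm a Jx).1. Qed.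

Lemma defect_one x : J x -> defect x one = - x.
Proof. by move=> Jx; rewrite /defect /ract /= P0 m0r sub0r add0r scale1r Pid. Qed.

Lemma defect_le a q : `|defect a q| <= 2 * `|C| * (`|a| * unorm q).
Proof.
(* The hypothesis gives only [0 <= C * |x|], which says nothing about [C] if [A] is trivial; hence
   the modulus. *)
have PC' x : `|P x| <= `|C| * `|x|.
  have Cx := PC x; have := le_trans (normr_ge0 _) Cx.
  by move=> /ger0_norm; rewrite normrM normr_id => ->.
rewrite (le_trans (ler_normB _ _))// -mulrA mulr2n mulrDl mul1r lerD//.
  rewrite (le_trans (mnorm _ _))// mulrCA ler_wpM2l// (le_trans (PC' _))//.
  by rewrite ler_wpM2l// lerDl.
by rewrite (le_trans (PC' _))// ler_wpM2l// ract_le.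
Qed.

Definition defect_fun (f : A -> R[i]) (t : T) : R[i] :=
  f (lact t.1.1 (defect t.1.2 t.2)).

Lemma defect_fun_wpred f : in_dual f -> defect_fun f \in wpred der_weight der_rel.
Proof.
move=> [flin [M fM]]; apply/asboolP; split; last first.
  move=> t0 k t1 t2; case=> {t0 k t1 t2} *; rewrite /defect_fun /= -flin.
  - by rewrite lact_linl.
  - by rewrite defect_linl lact_linr.
  - by rewrite defect_linr lact_linr.
  - by rewrite lact_uemb -lactM -lact_linr scale1r defectM.
have fM' a : `|f a| <= `|M| * `|a|.
  have := le_trans (normr_ge0 _) (fM a).
  by move=> /ger0_norm; rewrite normrM normr_id => ->.
pose B : R[i] := `|M| * (2 * `|C|).
have B0 : 0 <= B by rewrite !mulr_ge0.
exists (complex.Re B) => [|[[p a] q]]; first exact: Re_ge0.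
rewrite ReK// der_weight_norm /defect_fun /der_weight /= (le_trans (fM' _))//.
rewrite /B -[leRHS]mulrA ler_wpM2l// (le_trans (lact_le _ _))//.
by rewrite -[X in _ <= _ * X]mulrA [leRHS]mulrCA ler_wpM2l ?unorm_ge0// defect_le.
Qed.

Definition defect_form f (fd : in_dual f) : der_space := WSpace (defect_fun_wpred fd).

Lemma defect_form_la f (fd : in_dual f) x : J x -> der_la x (defect_form fd) = 0.
Proof.
move=> Jx; apply: wfun_inj => -[[p c] q] /=.
(* The last slot has become [q x], an element of [J], on which [P] is the identity. *)
rewrite /der_shl /defect_fun /= defect_uemb; last exact: Jlact.
have [flin _] := fd.
have -> : lact p 0 = 0 by rewrite /lact m0r scaler0 addr0.
by have := flin (-1) 0 0; rewrite scaler0 addr0 mulN1r addNr.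
Qed.

Lemma finite_right_approx : approx_semi_amenable m ->
  forall (n : nat) (x : 'I_n -> A), (forall k, J (x k)) ->
  forall e : R[i], 0 < e -> exists2 u, J u & forall k, `|m (x k) u - x k| <= e.
Proof.
move=> amen n x Jx.
pose W : set {ffun 'I_n -> A} := [set v | exists2 u, J u & v = [ffun k => m (x k) u]].
have [|k _ _ [u Ju ->] [v Jv ->]|appr|[phi [phid phiW phix]]] :=
    @finite_hahn_banach R A n W [ffun k => x k].
- by exists 0 => //; apply/ffunP => k; rewrite !ffunE m0r.
- exists (k *: u + v); first exact: Jlin.
  by apply/ffunP => j; rewrite !ffunE mlinr.
- move=> e /appr[_ [u Ju ->] ux]; exists u => // k.
  by have := ux k; rewrite !ffunE.
have {phiW} phiJ u : J u -> \sum_k phi k (m (x k) u) = 0.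
  move=> Ju; rewrite -[RHS](phiW [ffun k => m (x k) u]); last by exists u.
  by apply: eq_bigr => k _; rewrite ffunE.
have {}phix : \sum_k phi k (x k) != 0.
  by apply: contra_neq phix => px0; rewrite -[RHS]px0; apply: eq_bigr => k _; rewrite ffunE.
have [I [xi [eta [xid [etad cvg]]]]] := amen _ _ _ der_bimodule _ der_univ_cont_derivation.
(* An error of [e / (B + 1)] per unit of norm adds up to at most [e] over all test forms; the 1
   keeps the denominator positive. *)
pose B : R[i] := \sum_k `|defect_form (phid k)|.
suff : `|\sum_k phi k (x k)| <= 0 by rewrite normr_le0 (negbTE phix).
apply/ler_addgt0Pr => e e0; rewrite add0r.
have B0 : 0 <= B by exact: sumr_ge0.
have B1 : 0 < B + 1 by rewrite ltr_wpDl.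
have [i ihyp] : exists i, forall k, forall g,
    `|dual_lact der_ra (x k) (xi i) g - dual_ract der_la (eta i) (x k) g -
      der_univ (x k) g| <= e / (B + 1) * `|g|.
  have /choice[i0 i0P] k := cvg (x k) (e / (B + 1)) (divr_gt0 e0 B1).
  have [i iP] := directed_finite_ub i0.
  by exists i => k g; exact: i0P.
(* The forms already sum to zero: at [(p, c, q)] their sum is that of [phi k (m (x k) u)] with
   [u = lact p (defect c q)] in [J]. *)
have xi0 : \sum_k xi i (der_ra (defect_form (phid k)) (x k)) = 0.
  have [xlin _] := xid i.
  have x0 : xi i 0 = 0.
    by have := xlin (-1) 0 0; rewrite scaler0 addr0 mulN1r addNr.
  have xD g h : xi i (g + h) = xi i g + xi i h.
    by rewrite -[g]scale1r xlin mul1r scale1r.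
  rewrite -(big_morph _ xD x0) -[RHS]x0; congr (xi i).
  apply: wfun_inj => t.
  pose ev (g : der_space) : R[i] := g t.
  have -> : (\sum_k der_ra (defect_form (phid k)) (x k)) t =
      \sum_k (der_ra (defect_form (phid k)) (x k)) t by exact: (big_morph ev).
  rewrite [RHS](_ : _ = 0)// -[RHS](phiJ (lact t.1.1 (defect t.1.2 t.2))); last first.
    by apply: Jlact; exact: defect_J.
  by apply: eq_bigr => k _; rewrite /= /defect_fun /= lact_uemb mul_ract_lact.
have -> : \sum_k phi k (x k) = \sum_k (dual_lact der_ra (x k) (xi i) (defect_form (phid k))
    - dual_ract der_la (eta i) (x k) (defect_form (phid k))
    - der_univ (x k) (defect_form (phid k))).
  (* The [xi] terms cancel, the [eta] terms vanish one by one since [x k] kills the forms from the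
     left, and the derivation contributes [- phi k (x k)]. *)
  rewrite !sumrB xi0 sub0r [X in - X - _]big1 => [|k _].
    rewrite oppr0 sub0r -sumrN; apply: eq_bigr => k _.
    rewrite /der_univ /= /defect_fun /= defect_one// /lact /= m0l add0r scale1r.
    have [flin _] := phid k.
    have f0 : phi k 0 = 0.
      by have := flin (-1) 0 0; rewrite scaler0 addr0 mulN1r addNr.
    by have := flin (-1) (x k) 0; rewrite addr0 f0 addr0 scaleN1r mulN1r => ->; rewrite opprK.
  rewrite /dual_ract defect_form_la//; have [elin _] := etad i.
  by have := elin (-1) 0 0; rewrite scaler0 addr0 mulN1r addNr.
apply: le_trans (ler_norm_sum _ _ _) _.
apply: le_trans (ler_sum _ (fun k _ => ihyp k _)) _.
rewrite -mulr_sumr -/B -mulrA ler_piMr ?(ltW e0)// mulrC ler_pdivrMr// mul1r.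
by rewrite lerDl.
Qed.

End Defect.
End Derivation.

(** * Passage to the opposite algebra *)

Section Opposite.
Context {K : numFieldType} {A : completeNormedModType K} (m : A -> A -> A).

Lemma opposite_banach_algebra :
  is_banach_algebra m -> is_banach_algebra (fun a b => m b a).
Proof. by case=> mA ml mr mn; split=> // a b; rewrite mulrC. Qed.

(** Exchanging the two actions turns a bimodule over the opposite algebra into one over [A], with
    the same derivation. The two nets then trade places, each with a change of sign. *)
Lemma opposite_approx_semi_amenable :
  approx_semi_amenable m -> approx_semi_amenable (fun a b => m b a).
Proof.
move=> amen X la ra [l1 [l2 [r1 [r2 [lm [rm [lr [ln rn]]]]]]]] D [Dd Dlin Dm Dn].
have [||I [xi [eta [xid [etad cvg]]]]] :=
    amen X (fun a x => ra x a) (fun x a => la a x) _ D.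
- by do !split=> //; move=> a b x; rewrite lr.
- by split=> // a b x; rewrite Dm addrC.
have dualN (f : X -> K) : in_dual f -> in_dual (fun x => - f x).
  move=> [flin [M fM]]; split=> [k x y|]; first by rewrite flin opprD mulrN.
  by exists M => x; rewrite normrN.
exists I, (fun i x => - eta i x), (fun i x => - xi i x); split; [|split].
- by move=> i; exact: dualN.
- by move=> i; exact: dualN.
- move=> a e /(cvg a)[i0 i0P]; exists i0 => i /i0P h x.
  by rewrite /dual_lact /dual_ract opprK [- eta i _ + _]addrC; exact: h.
Qed.

End Opposite.

(** * From finite sets to nets, and the conclusion *)

Lemma linear_continuous_le (K : numFieldType) (A : normedModType K) (P : A -> A) :
  (forall (k : K) x y, P (k *: x + y) = k *: P x + P y) -> continuous P ->
  exists C, forall x, `|P x| <= C * `|x|.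
Proof.
move=> Plin Pcont.
pose L : {linear A -> A} := HB.pack P (GRing.isLinear.Build K A A *:%R P Plin).
have : bounded_near L (nbhs 0) by apply/linear_bounded_continuous.
by move=> /linear_boundedP/pinfty_ex_gt0[C _ PC]; exists C.
Qed.

(** The net is indexed by pairs of a finite list and a tolerance, ordered by inclusion and by
    decreasing tolerance. *)
Lemma right_approx_identity_of_finite (R : realType) (A : completeNormedModType R[i])
    (m : A -> A -> A) (J : set A) :
  (forall n (x : 'I_n -> A), (forall k, J (x k)) -> forall e : R[i], 0 < e ->
    exists2 u, J u & forall k, `|m (x k) u - x k| <= e) ->
  has_right_approx_identity m J.
Proof.
move=> fin.
have fin_seq (F : seq A) (e : {posnum R}) : exists u, J u /\
    forall x, x \in F -> J x -> `|m x u - x| <= (e%:num)%:C.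
  (* The lists range over all of [A], so they are first cut down to [J]. *)
  pose F' := [seq x <- F | x \in J].
  have [||u Ju uF] := fin (size F') (fun k => tnth (in_tuple F') k) _ (e%:num)%:C.
  - by move=> k; have := mem_tnth k (in_tuple F'); rewrite mem_filter => /andP[/set_mem].
  - by rewrite ltcR.
  exists u; split=> // x xF Jx.
  have /tnthP[k ->] : x \in in_tuple F' by rewrite mem_filter mem_set.
  exact: uF.
have /choice[u uP] (i : seq A * {posnum R}) := fin_seq i.1 i.2.
pose le (i j : seq A * {posnum R}) := {subset i.1 <= j.1} /\ j.2%:num <= i.2%:num.
have le_refl i : le i i by split.
have le_trans' i j k : le i j -> le j k -> le i k.
  by move=> [ij1 ij2] [jk1 jk2]; split=> [x /ij1/jk1//|]; exact: le_trans jk2 ij2.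
have le_dir i j : exists k, le i k /\ le j k.
  exists (i.1 ++ j.1, (Num.min i.2%:num j.2%:num)%:pos).
  split; split=> [x xi|] /=; rewrite ?mem_cat ?xi ?orbT// ge_min lexx ?orbT//.
exists (DirectedSet le_refl le_trans' (inhabits ([::], 1%:pos)) le_dir), u.
split=> [i|x Jx e e0]; first exact: (uP i).1.
have Re_gt0 : 0 < complex.Re e by rewrite -ltcR ReK ?(ltW e0).
exists ([:: x], PosNum Re_gt0) => i [/= xi ie].
apply: le_trans ((uP i).2 x (xi _ (mem_head _ _)) Jx) _.
by rewrite -(ReK (ltW e0)) lecR.
Qed.

Theorem theorem2p14 (R : realType) (A : completeNormedModType R[i])
  (m : A -> A -> A) (J : set A) :
  is_banach_algebra m ->
  approx_semi_amenable m ->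
  is_closed_ideal m J ->
  complemented J ->
  has_left_approx_identity m J /\ has_right_approx_identity m J.
Proof.
move=> Balg amen [J0 Jlin Jm _] [P [Plin Pcont PJ Pid]].
have [C PC] := linear_continuous_le Plin Pcont.
split.
  (* A left approximate identity is a right one for the opposite product. *)
  apply: (@right_approx_identity_of_finite _ _ (fun a b => m b a)).
  apply: (finite_right_approx (opposite_banach_algebra Balg) J0 Jlin _ Plin PC PJ Pid).
    by move=> a x Jx; have [] := Jm a x Jx.
  exact: opposite_approx_semi_amenable.
apply: right_approx_identity_of_finite.
exact: (finite_right_approx Balg J0 Jlin Jm Plin PC PJ Pid).
Qed.
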